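(* Let $w_1, w_2, d$ be positive integers with $w_1 \geq w_2$, and let $f\colon (\mathbb{R}^2,0)\to(\mathbb{R},0)$ be a non-degenerate weighted homogeneous polynomial of type $(d; w_1, w_2)$. Then the Łojasiewicz exponent of $f$ is $$ L(f)=\begin{cases} \dfrac{d-w_1}{w_2} & \text{if } \left\{(x_1,x_2)\in\mathbb{R}^2 : \dfrac{\partial f}{\partial x_1}(x_1,x_2)=0\right\}\subset\{(x_1,x_2)\in\mathbb{R}^2 : x_2=0\},\\[2mm] \dfrac{d}{w_2}-1 & \text{otherwise.} \end{cases} $$
   Context: A polynomial $f\in\mathbb{R}[x_1,\dots,x_n]$ is called weighted homogeneous of type $(d; w_1,\dots,w_n)$, where $d,w_1,\dots,w_n$ are positive integers, if it is a sum of real multiples of monomials $x_1^{\alpha_1}\cdots x_n^{\alpha_n}$ with $\alpha_1w_1+\cdots+\alpha_nw_n=d$. An analytic function $f\colon(\mathbb{R}^n,0)\to(\mathbb{R},0)$ (so $f(0)=0$) is called non-degenerate if $\{x : \frac{\partial f}{\partial x_1}(x)=\cdots=\frac{\partial f}{\partial x_n}(x)=0\}=\{0\}$ as germs of sets at the origin of $\mathbb{R}^n$; in particular the gradient of $f$ vanishes at $0$, and it vanishes at no other point of some neighborhood of $0$. The Łojasiewicz exponent of an analytic $f\colon(\mathbb{R}^n,0)\to(\mathbb{R},0)$ is $$L(f):=\inf\{\lambda>0 : \text{there exist } C>0 \text{ and a neighborhood } U \text{ of } 0 \text{ in } \mathbb{R}^n \text{ such that } |\operatorname{grad} f(x)|\geq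 C|x|^{\lambda} \text{ for all } x\in U\},$$ where $\operatorname{grad} f$ is the usual gradient and $|\cdot|$ the Euclidean norm. *)

(* Defs.v *)
(* mpoly must be imported before the analysis files: in the other order their
   notations clash. *)
From HB Require Import structures.
From mathcomp Require Import all_boot all_order all_algebra.
From mathcomp Require Import mpoly.
From mathcomp Require Import boolp classical_sets reals ereal topology.
From mathcomp Require Import normedtype derive exp.

Set Implicit Arguments.
Unset Strict Implicit.
Unset Printing Implicit Defensive.

Import Order.TTheory GRing.Theory Num.Theory.
Import numFieldNormedType.Exports.

Local Open Scope classical_set_scope.
Local Open Scope ring_scope.

Definition weighted_homogeneous (R : realType) (n : nat) (d : nat)
    (w : n.-tuple nat) (p : {mpoly R[n]}) : Prop :=
  forall m, m \in msupp p -> (\sum_(i < n) m i * tnth w i)%N = d.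

Definition mpoly_fun (R : realType) (n : nat) (p : {mpoly R[n]}) :
    'rV[R]_n -> R :=
  fun x => p.@[fun i => x 0 i].

Definition partial (R : realType) (n : nat) (i : 'I_n) (f : 'rV[R]_n -> R)
    (x : 'rV[R]_n) : R :=
  'D_(delta_mx 0 i) f x.

Definition grad (R : realType) (n : nat) (f : 'rV[R]_n -> R) (x : 'rV[R]_n) :
    'rV[R]_n :=
  \row_(i < n) partial i f x.

(* The library norm `|x| on 'rV[R]_n is the sup norm, hence this definition;
   both induce the same neighborhoods. *)
Definition enorm (R : realType) (n : nat) (x : 'rV[R]_n) : R :=
  Num.sqrt (\sum_(i < n) x 0 i ^+ 2).

(* Equality of the germs at 0 of the critical set and of {0}. Since 0 belongs
   to each of its neighborhoods, this includes grad f 0 = 0. *)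
Definition nondegenerate_germ (R : realType) (n : nat) (f : 'rV[R]_n -> R) : Prop :=
  \forall x \near (0 : 'rV[R]_n),
    (forall i : 'I_n, partial i f x = 0) <-> x = 0.

(* The infimum is taken in the extended reals, so that it is +oo (and not a
   default real number) when no exponent is admissible. As lambda > 0,
   0 `^ lambda = 0 and the inequality at x = 0 is harmless. *)
Definition lojasiewicz_exponent (R : realType) (n : nat) (f : 'rV[R]_n -> R) :
    \bar R :=
  ereal_inf [set lambda%:E | lambda in [set lambda : R | 0 < lambda /\
    exists2 C : R, 0 < C &
      \forall x \near (0 : 'rV[R]_n),
        C * enorm x `^ lambda <= enorm (grad f x)]].

(* Main.v *)
Require Import Defs.
From HB Require Import structures.
From mathcomp Require Import all_boot all_order all_algebra.
From mathcomp Require Import mpoly.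
From mathcomp Require Import boolp classical_sets reals ereal topology.
From mathcomp Require Import normedtype derive exp.
From mathcomp Require Import functions lra.

Set Implicit Arguments.
Unset Strict Implicit.
Unset Printing Implicit Defensive.

Import Order.TTheory GRing.Theory Num.Theory.
Import numFieldNormedType.Exports.

Local Open Scope classical_set_scope.
Local Open Scope ring_scope.

(** Write [F_1], [F_2] for the partial derivatives of [p] ([F 0] and [F 1] below)
    and let the weighted dilation [wscale w s] send [(x_1, x_2)] to
    [(s^w1 x_1, s^w2 x_2)].  Everything rests on the identity
    [F_i (wscale w s x) = s^(d - w_i) F_i x], i.e. on the fact that [F_i] is
    weighted homogeneous of degree [d - w_i].

    Lower bound on admissible exponents.  Along a curve [s |-> wscale w s u]
    with [u_2 <> 0] the norm is at least of order [s^w2], while the gradient is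
    at most of order [s^e] as soon as [e <= d - w_i] for the [i] with
    [F_i u <> 0].  So every admissible exponent is at least [e / w2].  Any [u]
    off the axis [x_2 = 0] allows [e = d - w1]; if [F_1] has a zero off that
    axis, starting there improves this to [e = d - w2].

    Admissibility of [e / w2].  A quantity [G] with
    [s^e G(u) <= G(wscale w s u)] for [0 < s <= 1] that is bounded below by some [c > 0] on the
    two lines [|u_j| = 1] satisfies [G(x) >= c |x_j|^(e / w_j)] for
    [0 < |x_j| <= 1] ([coord_growth]).  The bound on the non-compact lines is where
    polynomiality enters: a real polynomial in one variable without real root is
    bounded away from [0] ([poly_noroot_away0]).  Since [0] is the only critical
    point, globally and not just near [0] by dilation ([nondegenerate_global]),
    this applies to [G = |grad f|] with [e = d - w2] and both coordinates.  When
    [F_1] does not vanish off [x_2 = 0], it applies to [G = |F_1|] with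
    [e = d - w1], for the coordinate [x_2].  In either case the bound in [x_1],
    with exponent [(d - w2) / w1], is at least as strong as needed, which for
    [e = d - w1] follows from [w1 + w2 <= d] ([deg_ge_sum]); and [|x|] is
    comparable to [max(|x_1|, |x_2|)]. *)

(** * Real polynomials without real roots *)

(** By induction on [q = r X + a]: as [r] is eventually at least some [c > 0] in
    absolute value, [|r t|] eventually exceeds [1 + |a|]. *)
Lemma poly_away0_at_infty (R : realFieldType) (q : {poly R}) :
  q != 0 -> exists2 M : R, 0 <= M &
    exists2 c : R, 0 < c & forall t, M <= `|t| -> c <= `|q.[t]|.
Proof.
elim/poly_ind: q => [|q a IH]; first by rewrite eqxx.
have [->|q0] := eqVneq q 0.
  rewrite mul0r add0r polyC_eq0 => a0.
  by exists 0 => //; exists `|a| => [|t _]; rewrite ?normr_gt0// hornerC.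
move=> _; have [M M0 [c c0 cq]] := IH q0.
have a1c : 0 <= (1 + `|a|) / c by rewrite divr_ge0// ?ltW// addr_ge0.
exists (M + (1 + `|a|) / c); first exact: addr_ge0.
exists 1 => // t Mt; rewrite !hornerE.
have ct : c <= `|q.[t]| by apply: cq; apply: le_trans Mt; rewrite lerDl.
have : 1 + `|a| <= `|q.[t] * t|.
  rewrite normrM (@le_trans _ _ (c * `|t|))// ?ler_wpM2r//.
  by rewrite mulrC -ler_pdivrMr// (le_trans _ Mt)// lerDr.
have := lerB_normD (q.[t] * t) a; lra.
Qed.

(** Only a compact interval remains, on which [|q|] attains its minimum. *)
Lemma poly_noroot_away0 (R : realType) (q : {poly R}) :
  (forall t, q.[t] != 0) -> exists2 c : R, 0 < c & forall t, c <= `|q.[t]|.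
Proof.
move=> qn0; have q0 : q != 0 by apply: contraNneq (qn0 0) => ->; rewrite horner0.
have [M M0 [c c0 cq]] := poly_away0_at_infty q0.
have NMM : - M <= M by rewrite (le_trans _ M0)// oppr_le0.
have [u _ minu] : exists2 u, u \in `[- M, M]%R &
    forall t, t \in `[- M, M]%R -> `|q.[u]| <= `|q.[t]|.
  apply: (@EVT_min _ (fun t => `|q.[t]|)) => //;
    apply: continuous_subspaceT => t.
  by apply: cvg_norm; exact: continuous_horner.
exists (Num.min c `|q.[u]|); first by rewrite lt_min c0 normr_gt0 qn0.
move=> t; rewrite ge_min; have [tM|/ltW Mt] := lerP `|t| M.
  by rewrite minu ?orbT// in_itv/= -ler_norml.
by rewrite cq.
Qed.

(** * Polynomial functions, their partial derivatives and weighted dilations *)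

(** The polynomials for which the analytic derivative agrees with the formal one
    contain the constants and the variables and are stable under sums and
    products. *)
Lemma is_derive_mpoly_fun (R : realType) n (p : {mpoly R[n]}) (i : 'I_n)
    (x : 'rV[R]_n) :
  is_derive x (delta_mx 0 i) (mpoly_fun p) (mpoly_fun p^`M(i) x).
Proof.
pose D q := is_derive x (delta_mx 0 i) (mpoly_fun q) (mpoly_fun q^`M(i) x).
have DC c : D c%:MP.
  rewrite /D; have -> : mpoly_fun c%:MP = (fun=> c) :> ('rV[R]_n -> R).
    by apply/funext => y; rewrite /mpoly_fun mevalC.
  by rewrite mderivC /mpoly_fun meval0; exact: is_derive_cst.
have DU j : D 'X_j.
  rewrite /D; have -> : mpoly_fun 'X_j = fun y : 'rV[R]_n => y 0 j.
    by apply/funext => y; rewrite /mpoly_fun mevalXU.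
  have dq : (fun h : R => h^-1 *: (((fun y : 'rV[R]_n => y 0 j) \o shift x)
      (h *: delta_mx 0 i) - x 0 j)) @ 0^' --> mpoly_fun ('X_j)^`M(i) x.
    (* The difference quotient of a coordinate is constant. *)
    apply: cvg_near_cst; near=> h.
    have h0 : h != 0 by near: h; exact: nbhs_dnbhs_neq.
    rewrite /= !mxE eqxx/= addrK /GRing.scale/= mulrA mulVf// mul1r.
    rewrite /mpoly_fun mderivX mnmE mevalZ mevalX.
    have [<-|_] := eqVneq j i; last by rewrite mul0r.
    rewrite mul1r big1// => k _.
    by rewrite mnmBE subnn expr0.
  split; first by apply/cvg_ex; eexists; exact: dq.
  exact: cvg_lim dq.
have DM q r : D q -> D r -> D (q * r).
  move=> Dq Dr; rewrite /D.
  have -> : mpoly_fun (q * r) = mpoly_fun q * mpoly_fun r.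
    by apply/funext => y; rewrite /mpoly_fun mevalM.
  apply: (is_derive_eq (is_deriveM Dq Dr)).
  rewrite mderivM /mpoly_fun mevalD !mevalM addrC.
  by congr (_ + _); rewrite /GRing.scale/= mulrC.
have DD q r : D q -> D r -> D (q + r).
  move=> Dq Dr; rewrite /D.
  have -> : mpoly_fun (q + r) = mpoly_fun q + mpoly_fun r.
    by apply/funext => y; rewrite /mpoly_fun mevalD.
  by rewrite mderivD /mpoly_fun mevalD; exact: is_deriveD.
rewrite -/(D p) [p]mpolyE; apply: (big_ind D) => [|//|m _]; first exact: (DC 0).
rewrite -mul_mpolyC; apply: (DM) => //; rewrite mpolyXE_id.
apply: (big_ind D) => [|//|k _]; first exact: (DC 1).
elim: (m k) => [|e IHe]; first by rewrite expr0; exact: (DC 1).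
by rewrite exprS; exact: DM.
Unshelve. all: by end_near. Qed.

Lemma partial_mpoly_fun (R : realType) n (p : {mpoly R[n]}) (i : 'I_n) :
  partial i (mpoly_fun p) = mpoly_fun p^`M(i).
Proof. by apply/funext => x; have := is_derive_mpoly_fun p i x => -[]. Qed.

Definition wscale (R : realType) n (w : n.-tuple nat) (s : R) (x : 'rV[R]_n) :
  'rV[R]_n := \row_i (s ^+ tnth w i * x 0 i).

Lemma mpoly_fun_wscale (R : realType) n d (w : n.-tuple nat) (p : {mpoly R[n]})
    (s : R) (x : 'rV[R]_n) : weighted_homogeneous d w p ->
  mpoly_fun p (wscale w s x) = s ^+ d * mpoly_fun p x.
Proof.
move=> wh; rewrite /mpoly_fun !mevalE big_distrr/= !big_seq.
apply: eq_bigr => m /wh <-; rewrite mulrCA -prodrXr -big_split/=.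
by congr (_ * _); apply: eq_bigr => i _; rewrite mxE exprMn -exprM mulnC.
Qed.

(** The truncated subtraction is harmless: when [d < w_i] no monomial of [p]
    contains the [i]-th variable, hence [p^`M(i) = 0]. *)
Lemma weighted_homogeneous_mderiv (R : realType) n d (w : n.-tuple nat)
    (p : {mpoly R[n]}) (i : 'I_n) : weighted_homogeneous d w p ->
  weighted_homogeneous (d - tnth w i) w p^`M(i).
Proof.
move=> wh m; rewrite mcoeff_msupp mcoeff_deriv => mp.
have /wh <- : (m + U_(i))%MM \in msupp p.
  by rewrite mcoeff_msupp; apply: contraNneq mp => ->; rewrite mul0rn.
under [in RHS]eq_bigr do rewrite mnmDE mnm1E mulnDl.
rewrite big_split/= [X in (_ + X)%N](bigD1 i)//= eqxx mul1n.
rewrite [X in (_ + (_ + X))%N]big1 ?addn0 ?addnK// => j /negPf.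
by rewrite eq_sym => ->.
Qed.

Lemma mpoly_fun_line (R : realType) n (h : {mpoly R[n]}) (i : 'I_n)
    (x : 'rV[R]_n) :
  exists q : {poly R}, forall t, q.[t] = mpoly_fun h (x + t *: delta_mx 0 i).
Proof.
exists (\sum_(m <- msupp h) h@_m *: \prod_j
  ((x 0 j)%:P + ((j == i)%:R)%:P * 'X) ^+ m j) => t.
rewrite /mpoly_fun mevalE horner_sum; apply: eq_bigr => m _.
rewrite hornerZ horner_prod; congr (_ * _); apply: eq_bigr => j _.
by rewrite !hornerE !mxE eqxx/= mulrC.
Qed.

Lemma wscale0 (R : realType) n (w : n.-tuple nat) (x : 'rV[R]_n) :
  (forall i, (0 < tnth w i)%N) -> wscale w 0 x = 0.
Proof.
by move=> w0; apply/rowP => i; rewrite !mxE expr0n eqn0Ngt w0 mul0r.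
Qed.

Lemma cvg_wscale0 (R : realType) n (w : n.-tuple nat) (x : 'rV[R]_n) :
  (forall i, (0 < tnth w i)%N) -> wscale w s x @[s --> 0^'+] --> (0 : 'rV[R]_n).
Proof.
move=> w0 P /nbhs_ballP[e/= e0 eP].
pose M := 1 + \sum_i `|x 0 i|.
have M0 : 0 < M by rewrite ltr_pwDl// sumr_ge0.
suff : \forall s \near 0^'+, P (wscale w s x) by [].
near=> s; apply: eP; split=> // i0 i; rewrite ord1 /ball/= !mxE sub0r normrN.
have s0 : 0 < s by [].
have s1 : s <= 1 by near: s; exact: nbhs_right_le.
have sM : s * M < e.
  by rewrite -ltr_pdivlMr//; near: s; apply: nbhs_right_lt; rewrite divr_gt0.
apply: le_lt_trans sM; rewrite normrM normrX gtr0_norm// ler_pM//.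
- exact: exprn_ge0 (ltW _).
- by rewrite -[leRHS]expr1 ler_wiXn2l// ltW.
- by rewrite /M (bigD1 i)//= addrCA lerDl addr_ge0// sumr_ge0.
Unshelve. all: by end_near. Qed.

(** * The Euclidean norm *)

Lemma ler_enorm (R : realType) n (x y : 'rV[R]_n) :
  (forall i, `|x 0 i| <= `|y 0 i|) -> enorm x <= enorm y.
Proof.
move=> xy; rewrite ler_wsqrtr// ler_sum// => i _.
by rewrite -[leLHS]real_normK ?num_real// -[leRHS]real_normK ?num_real//
  lerXn2r ?nnegrE.
Qed.

Lemma enormZ (R : realType) n (a : R) (x : 'rV[R]_n) :
  enorm (a *: x) = `|a| * enorm x.
Proof.
rewrite /enorm -sqrtr_sqr -sqrtrM ?sqr_ge0// big_distrr/=.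
by congr Num.sqrt; apply: eq_bigr => i _; rewrite mxE exprMn.
Qed.

Lemma ler_coord_enorm (R : realType) n (x : 'rV[R]_n) i : `|x 0 i| <= enorm x.
Proof.
rewrite -sqrtr_sqr ler_wsqrtr// (bigD1 i)//= lerDl sumr_ge0// => j _.
exact: sqr_ge0.
Qed.

Lemma enorm_le_sum (R : realType) n (x : 'rV[R]_n) :
  enorm x <= \sum_i `|x 0 i|.
Proof.
have S0 : 0 <= \sum_i `|x 0 i| by rewrite sumr_ge0.
rewrite -[leRHS]ger0_norm// -sqrtr_sqr ler_wsqrtr//.
rewrite expr2 big_distrl/= ler_sum// => i _.
rewrite -real_normK ?num_real// expr2 ler_wpM2l// (bigD1 i)//= lerDl.
by rewrite sumr_ge0.
Qed.

(** * Growth of quasi-homogeneous quantities *)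

Lemma powR_root_exp (R : realType) (a : R) (w e : nat) : 0 < a -> (0 < w)%N ->
  (a `^ w%:R^-1) ^+ e = a `^ (e%:R / w%:R).
Proof. by move=> a0 w0; rewrite -powR_mulrn ?powR_ge0// -powRrM mulrC. Qed.

(** With [s = |x_j|^(1 / w_j)], the point [x] is the dilation by [s] of a point of
    [|u_j| = 1], where [G] is at least [c]. *)
Lemma coord_growth (R : realType) n (w : n.-tuple nat) (G : 'rV[R]_n -> R)
    (j : 'I_n) (e : nat) (c : R) : (0 < tnth w j)%N ->
  (forall (s : R) (u : 'rV[R]_n), 0 < s -> s <= 1 ->
     s ^+ e * G u <= G (wscale w s u)) ->
  (forall u : 'rV[R]_n, `|u 0 j| = 1 -> c <= G u) ->
  forall x : 'rV[R]_n, 0 < `|x 0 j| -> `|x 0 j| <= 1 ->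
    c * `|x 0 j| `^ (e%:R / (tnth w j)%:R) <= G x.
Proof.
move=> w0 Gs Gc x x0 x1; set s := `|x 0 j| `^ (tnth w j)%:R^-1.
have s0 : 0 < s by rewrite powR_gt0.
have s1 : s <= 1.
  have e1 : 1 = 1 `^ (tnth w j)%:R^-1 :> R by rewrite powR1.
  by rewrite [leRHS]e1 ge0_ler_powR ?nnegrE ?invr_ge0.
have sw : s ^+ tnth w j = `|x 0 j|.
  by rewrite powR_root_exp// divff ?pnatr_eq0 -?lt0n// powRr1.
pose y := wscale w s^-1 x.
have xE : wscale w s y = x.
  apply/rowP => i; rewrite !mxE mulrA -exprMn divff ?gt_eqF//.
  by rewrite expr1n mul1r.
have yj : `|y 0 j| = 1.
  rewrite mxE normrM normrX gtr0_norm ?invr_gt0//.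
  by rewrite exprVn sw mulVf// gt_eqF.
rewrite -powR_root_exp// -/s -xE; apply: le_trans (Gs _ _ s0 s1).
by rewrite mulrC ler_wpM2l ?exprn_ge0 ?(ltW s0)// Gc.
Qed.

(** In the plane, [|u_j| = 1] consists of two affine lines, on each of which [h] is
    a polynomial in one variable. *)
Lemma mpoly2_away0_lines (R : realType) (h : {mpoly R[2]}) (j : 'I_2) :
  (forall u : 'rV[R]_2, u 0 j != 0 -> mpoly_fun h u != 0) ->
  exists2 c : R, 0 < c &
    forall u : 'rV[R]_2, `|u 0 j| = 1 -> c <= `|mpoly_fun h u|.
Proof.
move=> h0; have hline (a : R) : a != 0 -> exists2 c : R, 0 < c &
    forall u : 'rV[R]_2, u 0 j = a -> c <= `|mpoly_fun h u|.
  (* In ['I_2] the index other than [j] is [1 - j]. *)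
  move=> a0; have [q qE] := mpoly_fun_line h (1 - j) (a *: delta_mx 0 j).
  have jN : (j == 1 - j) = false by case: j {h0 qE} => -[|[|]].
  have qn0 t : q.[t] != 0.
    by rewrite qE h0// !mxE !eqxx jN mulr1 mulr0 addr0.
  have [c c0 cq] := poly_noroot_away0 qn0; exists c => // u ua.
  suff -> : u = a *: delta_mx 0 j + u 0 (1 - j) *: delta_mx 0 (1 - j).
    by rewrite -qE.
  apply/rowP => i; rewrite !mxE !eqxx/=.
  have [->|ij] := eqVneq i j; first by rewrite jN mulr1 mulr0 addr0.
  have -> : i = 1 - j.
    move: ij; case: i j {h0 jN qE ua} => -[|[|//]] ? [[|[|//]] ?] //= _;
    exact/val_inj.
  by rewrite eqxx mulr0 mulr1 add0r.
have [c c0 ch] := hline 1 (oner_neq0 _).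
have [c' c'0 c'h] := hline (-1) ltac:(by rewrite oppr_eq0 oner_eq0).
exists (Num.min c c'); first by rewrite lt_min c0.
move=> u /eqP; rewrite eqr_norml ler01 andbT ge_min => /orP[]/eqP uj.
  by rewrite ch.
by rewrite c'h// orbT.
Qed.

(** * Admissible exponents *)

(** Test the inequality on the curve [s |-> wscale w s u]: its left-hand side is
    at least of order [s^(w_j l)], its right-hand side at most of order [s^e], so
    [w_j l < e] is impossible as [s] tends to [0]. *)
Lemma admissible_exponent_ge (R : realType) n (w : n.-tuple nat)
    (G : 'rV[R]_n -> R) (u : 'rV[R]_n) (j : 'I_n) (e : nat) (K C l : R) :
  (forall i, (0 < tnth w i)%N) -> u 0 j != 0 -> 0 <= K ->
  (forall s : R, 0 < s -> s <= 1 -> G (wscale w s u) <= s ^+ e * K) ->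
  0 < l -> 0 < C -> (\forall x \near (0 : 'rV[R]_n), C * enorm x `^ l <= G x) ->
  e%:R / (tnth w j)%:R <= l.
Proof.
move=> w0 uj K0 GK l0 C0 CG; rewrite leNgt; apply/negP.
rewrite ltr_pdivlMr ?ltr0n// -subr_gt0; set r := e%:R - _ => r0.
have a0 : 0 < C * `|u 0 j| `^ l by rewrite mulr_gt0// powR_gt0// normr_gt0.
suff : \forall s \near (0 : R)^'+, False by move=> /filter_ex[].
near=> s.
have s0 : 0 < s by [].
have s1 : s <= 1 by near: s; exact: nbhs_right_le.
have : C * enorm (wscale w s u) `^ l <= G (wscale w s u).
  by near: s; exact: cvg_wscale0 CG.
have small : s `^ r < C * `|u 0 j| `^ l / (K + 1).
  near: s; apply: (cvgr_lt (0 : R)); first exact: powR_cvg0.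
  by rewrite divr_gt0// ltr_wpDl.
apply/negP; rewrite -ltNge; apply: le_lt_trans (GK _ s0 s1) _.
have : C * (s ^+ tnth w j * `|u 0 j|) `^ l <= C * enorm (wscale w s u) `^ l.
  rewrite ler_wpM2l ?(ltW C0)// ge0_ler_powR ?(ltW l0) ?nnegrE ?sqrtr_ge0//.
    by rewrite mulr_ge0 ?exprn_ge0 ?(ltW s0).
  apply: le_trans (ler_coord_enorm _ j).
  by rewrite mxE normrM normrX gtr0_norm.
apply: lt_le_trans.
have -> : (s ^+ tnth w j * `|u 0 j|) `^ l =
    s `^ ((tnth w j)%:R * l) * `|u 0 j| `^ l.
  by rewrite powRM ?exprn_ge0 ?(ltW s0)// powRrM powR_mulrn ?(ltW s0).
have -> : s ^+ e = s `^ ((tnth w j)%:R * l) * s `^ r.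
  rewrite -powRD ?(gt_eqF s0) ?implybT// -powR_mulrn ?(ltW s0)//.
  by congr (_ `^ _); rewrite /r; lra.
rewrite mulrCA -mulrA ltr_pM2l ?powR_gt0//.
move: small; rewrite ltr_pdivlMr ?ltr_wpDl// => /(le_lt_trans _); apply.
by rewrite ler_wpM2l ?powR_ge0// lerDl.
Unshelve. all: by end_near. Qed.

(** Near [0], [|x| <= 2 |x_j|] for the larger coordinate [x_j], so the bound in
    that coordinate suffices. *)
Lemma admissible_exponent_of_coord_growth (R : realType) (G : 'rV[R]_2 -> R)
    (l c0 c1 : R) :
  0 < l -> 0 < c0 -> 0 < c1 -> (forall x, 0 <= G x) ->
  (forall x : 'rV[R]_2, 0 < `|x 0 0| -> `|x 0 0| <= 1 ->
     c0 * `|x 0 0| `^ l <= G x) ->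
  (forall x : 'rV[R]_2, 0 < `|x 0 1| -> `|x 0 1| <= 1 ->
     c1 * `|x 0 1| `^ l <= G x) ->
  exists2 C : R, 0 < C &
    \forall x \near (0 : 'rV[R]_2), C * enorm x `^ l <= G x.
Proof.
move=> l0 c00 c10 G0 Gc0 Gc1; exists (Num.min c0 c1 / 2 `^ l).
  by rewrite divr_gt0 ?powR_gt0// lt_min c00.
have bnd (c : R) (x : 'rV[R]_2) j : 0 <= c -> enorm x <= 2 * `|x 0 j| ->
    `|x 0 j| <= 1 ->
    (0 < `|x 0 j| -> `|x 0 j| <= 1 -> c * `|x 0 j| `^ l <= G x) ->
    c / 2 `^ l * enorm x `^ l <= G x.
  move=> c_0 xj x1 Gc; have := normr_ge0 (x 0 j).
  rewrite le_eqVlt => /predU1P[x0|x0].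
    move: xj; rewrite -x0 mulr0 => x_0; have -> : enorm x = 0.
      by apply/eqP; rewrite eq_le x_0 sqrtr_ge0.
    by rewrite powR0 ?gt_eqF// mulr0.
  apply: le_trans (Gc x0 x1); rewrite -mulrA ler_wpM2l// ler_pdivrMl ?powR_gt0//.
  by rewrite -powRM ?sqrtr_ge0// ge0_ler_powR ?(ltW l0)//
    nnegrE ?sqrtr_ge0// mulr_ge0.
near=> x.
have x1 i : `|x 0 i| <= 1.
  move: i; near: x; apply/nbhs_ballP; exists 1 => //= y yb i.
  by have := yb.2 0 i; rewrite /ball/= mxE sub0r normrN => /ltW.
have := enorm_le_sum x; rewrite !big_ord_recl big_ord0 addr0 /=.
rewrite (_ : lift _ _ = 1); last exact/val_inj.
have m0 : 0 <= Num.min c0 c1 by rewrite le_min !ltW.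
have [x10|x01] := lerP `|x 0 1| `|x 0 0| => xs.
  apply: (bnd _ _ 0) => // [|h0 h1]; first by apply: le_trans xs _; lra.
  by apply: le_trans (Gc0 _ h0 h1); rewrite ler_wpM2r ?powR_ge0// ge_min lexx.
apply: (bnd _ _ 1) => // [|h0 h1]; first by apply: le_trans xs _; lra.
by apply: le_trans (Gc1 _ h0 h1); rewrite ler_wpM2r ?powR_ge0// ge_min lexx orbT.
Unshelve. all: by end_near. Qed.

(** * Non-degenerate weighted homogeneous polynomials in two variables *)

Section TwoWeights.
Variables (R : realType) (w1 w2 d : nat) (p : {mpoly R[2]}).
Hypotheses (w1_gt0 : (0 < w1)%N) (w2_gt0 : (0 < w2)%N) (le_w : (w2 <= w1)%N).
Let w : 2.-tuple nat := [tuple w1; w2].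
Hypothesis p_wh : weighted_homogeneous d w p.
Hypothesis p_nd : nondegenerate_germ (mpoly_fun p).

Let F i := mpoly_fun p^`M(i).
Let f := mpoly_fun p.

Let ordP (P : 'I_2 -> Prop) : P 0 -> P 1 -> forall i, P i.
Proof.
move=> P0 P1 [[|[|//]] i2].
  by rewrite (_ : Ordinal i2 = 0)//; exact/val_inj.
by rewrite (_ : Ordinal i2 = 1)//; exact/val_inj.
Qed.

Let w_gt0 i : (0 < tnth w i)%N.
Proof. by move: i; apply: ordP. Qed.

Let w_ge i : (w2 <= tnth w i)%N.
Proof. by move: i; apply: ordP => //; rewrite /tnth/=. Qed.

Lemma partial_wscale i s x :
  F i (wscale w s x) = s ^+ (d - tnth w i) * F i x.
Proof. exact/mpoly_fun_wscale/weighted_homogeneous_mderiv. Qed.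

(** A critical point dilates to critical points arbitrarily close to [0]. *)
Lemma nondegenerate_global x : (forall i, F i x = 0) <-> x = 0.
Proof.
have nd : \forall x \near (0 : 'rV[R]_2), (forall i, F i x = 0) <-> x = 0.
  move: p_nd; apply: filterS => y [y1 y2]; split=> [yF|/y2 yF i].
    by apply: y1 => i; rewrite partial_mpoly_fun; exact: yF.
  by rewrite /F -partial_mpoly_fun yF.
split=> [xF|->]; last exact: (nbhs_singleton nd).2.
have [s [s0 [sx _]]] : exists s : R, 0 < s /\
    ((forall i, F i (wscale w s x) = 0) <-> wscale w s x = 0).
  apply: (@filter_ex _ (0 : R)^'+).
  by apply: filterI; [exact: nbhs_right_gt | exact: (cvg_wscale0 x w_gt0) nd].
apply/rowP => i; have /rowP/(_ i) : wscale w s x = 0.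
  by apply: sx => k; rewrite partial_wscale xF mulr0.
move=> /eqP; rewrite !mxE mulf_eq0 expf_eq0 (gt_eqF s0) andbF/=.
by move=> /eqP.
Qed.

(** [F i] then has weighted degree [0], so it is invariant under the dilation by
    [0], which collapses the plane to the critical point [0]. *)
Lemma partial_deg0 i x : (d <= tnth w i)%N -> F i x = 0.
Proof.
rewrite -subn_eq0 => /eqP di; have := partial_wscale i 0 x.
rewrite wscale0// di expr0 mul1r => <-.
exact: (nondegenerate_global 0).2.
Qed.

(** Otherwise both partial derivatives would vanish identically. *)
Lemma deg_gt_w2 : (w2 < d)%N.
Proof.
rewrite ltnNge; apply/negP => dw.
have /rowP/(_ 0)/eqP : const_mx 1 = 0 :> 'rV[R]_2.
  by apply/nondegenerate_global => i; apply: partial_deg0; apply: leq_trans dw _.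
by rewrite !mxE oner_eq0.
Qed.

Lemma grad_coord x i : grad f x 0 i = F i x.
Proof. by rewrite mxE partial_mpoly_fun. Qed.

Lemma admissible_exponent_ge_of_point (u : 'rV[R]_2) (e : nat) l :
  u 0 1 != 0 ->
  (forall i, F i u != 0 -> (e <= d - tnth w i)%N) ->
  [set lambda : R | 0 < lambda /\ exists2 C : R, 0 < C &
      \forall x \near (0 : 'rV[R]_2),
        C * enorm x `^ lambda <= enorm (grad f x)] l ->
  e%:R / w2%:R <= l.
Proof.
move=> u1 ue [l0 [C C0 CG]].
apply: (admissible_exponent_ge (j := 1) (K := enorm (grad f u)) (w := w)
  w_gt0 u1 _ _ l0 C0 CG).
  exact: sqrtr_ge0.
move=> s s0 s1; rewrite -[s ^+ e]ger0_norm ?exprn_ge0 ?(ltW s0)// -enormZ.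
apply: ler_enorm => i; rewrite [in leRHS]mxE !grad_coord partial_wscale.
have [->|/ue ei] := eqVneq (F i u) 0; first by rewrite !mulr0.
rewrite !normrM ler_wpM2r// !ger0_norm ?exprn_ge0 ?(ltW s0)//.
by rewrite ler_wiXn2l// ltW.
Qed.

(** [|grad f|^2] is a polynomial whose only zero is [0], so it has no zero on the
    lines [|x_j| = 1]; and dilating by [s <= 1] shrinks the gradient at most by
    the factor [s^(d - w2)], [w2] being the smaller weight. *)
Lemma grad_growth j : exists2 c : R, 0 < c & forall x : 'rV[R]_2,
  0 < `|x 0 j| -> `|x 0 j| <= 1 ->
  c * `|x 0 j| `^ ((d - w2)%:R / (tnth w j)%:R) <= enorm (grad f x).
Proof.
pose g := \sum_i p^`M(i) ^+ 2.
have gE x : mpoly_fun g x = \sum_i F i x ^+ 2.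
  by rewrite /mpoly_fun raddf_sum/=; apply: eq_bigr => i _; rewrite rmorphXn.
have [c c0 cg] : exists2 c : R, 0 < c &
    forall u : 'rV[R]_2, `|u 0 j| = 1 -> c <= `|mpoly_fun g u|.
  apply: mpoly2_away0_lines => u; apply: contra_neq => /eqP.
  rewrite gE psumr_eq0 => [/allP uF|i _]; last exact: sqr_ge0.
  have -> : u = 0; last by rewrite mxE.
  apply/nondegenerate_global => i.
  by have /implyP/(_ isT) := uF i (mem_index_enum _); rewrite sqrf_eq0 => /eqP.
exists (Num.sqrt c); first by rewrite sqrtr_gt0.
apply: coord_growth => // [s u s0 s1|u /cg].
  rewrite -[s ^+ _]ger0_norm ?exprn_ge0 ?(ltW s0)// -enormZ.
  apply: ler_enorm => i; rewrite [in leLHS]mxE !grad_coord partial_wscale.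
  rewrite !normrM ler_wpM2r// !ger0_norm ?exprn_ge0 ?(ltW s0)//.
  by rewrite ler_wiXn2l ?(ltW s0)// leq_sub2l.
rewrite gE ger0_norm ?sumr_ge0// => [cu|i _]; last exact: sqr_ge0.
by rewrite ler_wsqrtr//; under eq_bigr do rewrite grad_coord.
Qed.

Lemma partial0_growth :
  (forall x : 'rV[R]_2, F 0 x = 0 -> x 0 1 = 0) ->
  exists2 c : R, 0 < c & forall x : 'rV[R]_2,
  0 < `|x 0 1| -> `|x 0 1| <= 1 ->
  c * `|x 0 1| `^ ((d - w1)%:R / w2%:R) <= enorm (grad f x).
Proof.
move=> F0; have [c c0 cF] : exists2 c : R, 0 < c &
    forall u : 'rV[R]_2, `|u 0 1| = 1 -> c <= `|F 0 u|.
  apply: mpoly2_away0_lines => u; apply: contra_neq; exact: F0.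
exists c => // x x0 x1; apply: (@le_trans _ _ `|F 0 x|); last first.
  by rewrite -grad_coord ler_coord_enorm.
apply: (@coord_growth _ _ w (fun x => `|F 0 x|) 1) => // s u s0 s1.
by rewrite partial_wscale normrM ger0_norm// exprn_ge0// ltW.
Qed.

(** [F 0] has positive degree [d - w1] by [partial_deg0], so each of its monomials
    contains a variable and hence has weight at least [w2]. *)
Lemma deg_ge_sum (x : 'rV[R]_2) : F 0 x != 0 -> (w1 + w2 <= d)%N.
Proof.
move=> F0; have d1 : (w1 < d)%N.
  by rewrite ltnNge; apply: contra F0 => dw; rewrite partial_deg0.
have /mlead_supp : p^`M(0) != 0.
  by apply: contra F0 => /eqP p0; rewrite /F p0 /mpoly_fun meval0.
set m := mlead _ => /(weighted_homogeneous_mderiv p_wh).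
rewrite !big_ord_recl big_ord0 addn0 -/w /tnth/= => mE.
rewrite -leq_subRL ?(ltnW d1)// -mE.
have : (0 < d - w1)%N by rewrite subn_gt0.
rewrite -mE addn_gt0 !muln_gt0 => /orP[]/andP[m_gt0 _].
  by rewrite (leq_trans le_w)// (leq_trans _ (leq_addr _ _))// leq_pmull.
by rewrite (leq_trans _ (leq_addl _ _))// leq_pmull.
Qed.

(** The common end of both cases: [u] starts the curve that bounds the exponent
    from below, and [e] bounds the growth in the second coordinate.  The
    comparison of [(d - w2) * w2] and [e * w1] says that the growth in the first
    coordinate, of exponent [(d - w2) / w1], is not the weaker one. *)
Lemma lojasiewicz_exponent_eq (u : 'rV[R]_2) (e : nat) (c : R) :
  u 0 1 != 0 -> (forall i, F i u != 0 -> (e <= d - tnth w i)%N) ->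
  (0 < e)%N -> ((d - w2) * w2 <= e * w1)%N -> 0 < c ->
  (forall x : 'rV[R]_2, 0 < `|x 0 1| -> `|x 0 1| <= 1 ->
     c * `|x 0 1| `^ (e%:R / w2%:R) <= enorm (grad f x)) ->
  lojasiewicz_exponent f = (e%:R / w2%:R)%:E.
Proof.
move=> u1 ue e0 ew c0 cf; apply/eqP; rewrite eq_le; apply/andP.
split; last first.
  apply: le_ereal_inf_tmp => _ [l lS <-]; rewrite lee_fin.
  exact: admissible_exponent_ge_of_point u1 ue lS.
apply: ereal_inf_lbound; exists (e%:R / w2%:R) => //; split.
  by rewrite divr_gt0// ltr0n.
have [c' c'0 c'f] := grad_growth 0.
apply: (admissible_exponent_of_coord_growth _ c'0 c0 _ _ cf) => [||x x0 x1].
- by rewrite divr_gt0// ltr0n.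
- by move=> x; exact: sqrtr_ge0.
apply: le_trans (c'f _ x0 x1); rewrite ler_pM2l// ger_powR ?x0//.
rewrite ler_pdivrMr ?ltr0n// mulrAC ler_pdivlMr ?ltr0n//.
by rewrite -!natrM ler_nat.
Qed.

End TwoWeights.

Theorem theorem3 (R : realType) (w1 w2 d : nat)
  (w1_gt0 : (0 < w1)%N) (w2_gt0 : (0 < w2)%N) (d_gt0 : (0 < d)%N)
  (le_w : (w2 <= w1)%N)
  (p : {mpoly R[2]})
  (p_wh : weighted_homogeneous d [tuple w1; w2] p)
  (p0 : mpoly_fun p 0 = 0)
  (p_nd : nondegenerate_germ (mpoly_fun p)) :
  lojasiewicz_exponent (mpoly_fun p) =
    (if `[< [set x : 'rV[R]_2 | partial (0 : 'I_2) (mpoly_fun p) x = 0]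
            `<=` [set x : 'rV[R]_2 | x 0 (1 : 'I_2) = 0] >]
     then (d%:R - w1%:R) / w2%:R
     else d%:R / w2%:R - 1)%:E.
Proof.
have d_gt2 := deg_gt_w2 w1_gt0 w2_gt0 le_w p_wh p_nd.
case: asboolP => [sub|nsub].
  have e1 : (delta_mx 0 1 : 'rV[R]_2) 0 1 != 0 by rewrite mxE !eqxx oner_eq0.
  have F0 x : mpoly_fun p^`M(0) x = 0 -> x 0 1 = 0.
    by move=> Fx; apply: sub; rewrite /= partial_mpoly_fun.
  have d_ge := deg_ge_sum w1_gt0 w2_gt0 le_w p_wh p_nd (contra_neq (F0 _) e1).
  have [c c0 cf] := partial0_growth w2_gt0 p_wh F0.
  rewrite -natrB ?(leq_trans (leq_addr _ _) d_ge)//.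
  apply: (lojasiewicz_exponent_eq w1_gt0 w2_gt0 le_w p_wh p_nd e1 _ _ _ c0 cf).
  - move=> i _; rewrite leq_sub2l//.
    by case: i => -[|[|//]].
  - rewrite subn_gt0 (leq_trans _ d_ge)// -[ltnLHS]addn0 ltn_add2l//.
  - (* With [b = d - w1 - w2], this reads [(b + w1) w2 <= (b + w2) w1]. *)
    have [b ->] : exists b, d = (b + (w1 + w2))%N.
      by exists (d - (w1 + w2))%N; rewrite subnK.
    rewrite [X in (_ <= (X - _) * _)%N]addnCA addKn addnA addnK.
    by rewrite !mulnDl [(w2 * w1)%N]mulnC leq_add2r leq_mul2l le_w orbT.
have [x [Fx x1]] : exists x : 'rV[R]_2, mpoly_fun p^`M(0) x = 0 /\ x 0 1 != 0.
  apply: contra_notP nsub => /forallNP nx x /= Fx.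
  apply/eqP; rewrite -[_ == _]negbK; apply/negP => x1.
  by apply: (nx x); rewrite -partial_mpoly_fun.
have [c c0 cf] := grad_growth w1_gt0 w2_gt0 le_w p_wh p_nd 1.
have -> : d%:R / w2%:R - 1 = (d - w2)%:R / w2%:R :> R.
  by rewrite natrB ?(ltnW d_gt2)// mulrBl divff// pnatr_eq0 -lt0n.
apply: (lojasiewicz_exponent_eq w1_gt0 w2_gt0 le_w p_wh p_nd x1 _ _ _ c0 cf).
- case=> -[|[|//]] i2; last by rewrite /tnth.
  by rewrite (_ : Ordinal i2 = 0) ?Fx ?eqxx//; exact/val_inj.
- by rewrite subn_gt0.
- by rewrite leq_mul2l le_w orbT.
Qed.
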